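(* Let $n$ be a positive integer and let $\dot z\in\mathbb{C}$ be nonzero. Fix a square root $\sqrt{\dot z}$. Then there is a homomorphism of associative algebras $$\theta_{\dot z}:\ U(\mathfrak{s}_n)/\langle z-\dot z\rangle\rightarrow \mathfrak{D}_n$$ defined by, for $1\leq i,j\leq n$, $$x_i\mapsto \tilde x_i:=\sqrt{\dot z}\,\partial_i,\qquad y_i\mapsto \tilde y_i:=\sqrt{\dot z}\,t_i,$$ $$e\mapsto \tilde e:=\tfrac12\sum_{k=1}^n\partial_k^2,\qquad f\mapsto\tilde f:=-\tfrac12\sum_{k=1}^n t_k^2,$$ $$h\mapsto\tilde h:=-\tfrac12\sum_{k=1}^n(\partial_kt_k+t_k\partial_k),\qquad s_{ij}\mapsto\tilde s_{ij}:=t_i\partial_j-t_j\partial_i.$$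
   Context: For a positive integer $n$, the Schrödinger Lie algebra $\mathfrak{s}_n=(\mathfrak{sl}_2\oplus\mathfrak{so}_n)\ltimes\mathfrak{h}_n$ is the complex Lie algebra with basis $e,f,h$ (spanning $\mathfrak{sl}_2$), $s_{ij}$ for $1\leq i<j\leq n$ (spanning $\mathfrak{so}_n$, the skew-symmetric $n\times n$ matrices, with $s_{ij}$ corresponding to $e_{ij}-e_{ji}$), and $x_1,\dots,x_n,y_1,\dots,y_n,z$ (spanning the Heisenberg algebra $\mathfrak{h}_n$). Put $s_{ji}=-s_{ij}$, $s_{ii}=0$. The non-trivial brackets are $$[h,e]=2e,\ [h,f]=-2f,\ [e,f]=h,\quad [x_i,y_i]=z,\ [h,x_i]=x_i,\ [h,y_i]=-y_i,\quad [e,y_i]=x_i,\ [f,x_i]=y_i,$$ $$[s_{kl},x_i]=\delta_{li}x_k-\delta_{ki}x_l,\quad [s_{kl},y_i]=\delta_{li}y_k-\delta_{ki}y_l,$$ $$[s_{ij},s_{kl}]=\delta_{kj}s_{il}+\delta_{il}s_{jk}+\delta_{lj}s_{ki}+\delta_{ki}s_{lj};$$ all other brackets between basis elements of different types, and $[x_i,x_j]$, $[y_i,y_j]$, $[x_i,y_j]$ for $i\ne j$, vanish; $z$ is central. For $n=1$, $\mathfrak{so}_1=0$. $U(\cdot)$ denotes the universal enveloping algebra, and $\langle z-\dot z\rangle$ is the two-sided ideal generated by $z-\dot z$. $\mathfrak{D}_n$ is the Weyl algebra of rank $n$: the associative $\mathbb{C}$-algebra generated by $t_1,\dots,t_n,\partial_1,\dots,\partial_n$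 with relations $[\partial_i,\partial_j]=[t_i,t_j]=0$, $[\partial_i,t_j]=\delta_{i,j}$. *)

(* Defs.v *)
From HB Require Import structures.
From mathcomp Require Import all_boot all_order all_algebra.
From mathcomp Require Import boolp classical_sets reals.
From mathcomp Require Import complex ring.
From mathcomp Require Import monalg.

Set Implicit Arguments.
Unset Strict Implicit.
Unset Printing Implicit Defensive.

Import GRing.Theory.
Local Open Scope quotient_scope.
Local Open Scope classical_set_scope.
Local Open Scope ring_scope.

Section Ideals.
Variable A : pzRingType.

Definition two_sided_ideal (I : set A) : Prop :=
  [/\ I 0, forall u v, I u -> I v -> I (u - v),
      forall u v, I v -> I (u * v) & forall u v, I u -> I (u * v)].

Definition ideal_gen (S : set A) : set A := smallest two_sided_ideal S.

Lemma sub_ideal_gen S : S `<=` ideal_gen S.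
Proof. exact: sub_smallest. Qed.

Lemma ideal_gen_min S I : two_sided_ideal I -> S `<=` I -> ideal_gen S `<=` I.
Proof. exact: smallest_sub. Qed.

Lemma ideal_genP S : two_sided_ideal (ideal_gen S).
Proof.
split=> [I [[]]//|u v Iu Iv I IP|u v Iv I IP|u v Iu I IP].
- by case: (IP) => -[_ H _ _] _; apply: H; [apply: Iu | apply: Iv].
- by case: (IP) => -[_ _ H _] _; apply: H; apply: Iv.
- by case: (IP) => -[_ _ _ H] _; apply: H; apply: Iu.
Qed.

Definition ideal_pred (S : set A) : {pred A} := fun u => `[< ideal_gen S u >].

Fact ideal_pred_zmod_closed S : zmod_closed (ideal_pred S).
Proof.
have [I0 IB _ _] := ideal_genP S.
split=> [|u v /asboolP Iu /asboolP Iv]; apply/asboolP => //.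
exact: IB.
Qed.

HB.instance Definition _ S :=
  GRing.isZmodClosed.Build A (ideal_pred S) (ideal_pred_zmod_closed S).

End Ideals.

Section AlgebraQuotient.
Variables (K : comNzRingType) (A : algType K) (S : set A).

Definition alg_quot : Type := Quotient.quot (ideal_pred S).

HB.instance Definition _ := Choice.on alg_quot.
HB.instance Definition _ := GRing.Zmodule.on alg_quot.

(* The operations are locked: otherwise unification unfolds them to
   representatives when comparing elements of iterated quotients. *)
Fact alg_quot_key : unit. Proof. by []. Qed.

Definition alg_pi : A -> alg_quot :=
  locked_with alg_quot_key \pi_(Quotient.quot (ideal_pred S)).

Definition quot_one : alg_quot := alg_pi 1.
Definition quot_mul : alg_quot -> alg_quot -> alg_quot :=
  locked_with alg_quot_key (fun x y => alg_pi ((repr x : A) * (repr y : A))).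
Definition quot_scale : K -> alg_quot -> alg_quot :=
  locked_with alg_quot_key (fun a x => alg_pi (a *: (repr x : A))).

Canonical alg_pi_unlockable := [unlockable fun alg_pi].
Canonical quot_mul_unlockable := [unlockable fun quot_mul].
Canonical quot_scale_unlockable := [unlockable fun quot_scale].

Lemma alg_pi_eq u v : (alg_pi u = alg_pi v) <-> ideal_gen S (u - v).
Proof.
rewrite [alg_pi]unlock; split=> [/eqP|H]; last apply/eqP.
  by rewrite -Quotient.idealrBE => /asboolP.
by rewrite -Quotient.idealrBE; apply/asboolP.
Qed.

Lemma alg_piK x : alg_pi (repr x) = x.
Proof. by rewrite [alg_pi]unlock; exact: reprK. Qed.

Lemma alg_pi_ind (P : alg_quot -> Prop) : (forall u, P (alg_pi u)) -> forall x, P x.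
Proof. by move=> H x; rewrite -[x]alg_piK. Qed.

Lemma alg_piB u v : alg_pi (u - v) = alg_pi u - alg_pi v.
Proof. by rewrite [alg_pi]unlock [LHS]Quotient.pi_add Quotient.pi_opp. Qed.

Lemma alg_pi0 : alg_pi 0 = 0.
Proof. by rewrite -(subrr 0) alg_piB subrr. Qed.

Lemma alg_piD u v : alg_pi (u + v) = alg_pi u + alg_pi v.
Proof. by rewrite -[v in LHS]opprK alg_piB -[- v]sub0r alg_piB alg_pi0 sub0r opprK. Qed.

Lemma alg_pi_mul u v : alg_pi (u * v) = quot_mul (alg_pi u) (alg_pi v).
Proof.
have [_ IB IL IR] := ideal_genP S.
rewrite [quot_mul]unlock; apply/alg_pi_eq; set u' := repr _; set v' := repr _.
have Iu : ideal_gen S (u - u') by apply/alg_pi_eq; rewrite alg_piK.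
have Iv : ideal_gen S (v' - v) by apply/alg_pi_eq; rewrite alg_piK.
suff -> : u * v - u' * v' = (u - u') * v - u' * (v' - v) :> A.
  by apply: IB; [exact: IR | exact: IL].
by rewrite mulrBl mulrBr opprB addrA subrK.
Qed.

Lemma alg_pi_scale a u : alg_pi (a *: u) = quot_scale a (alg_pi u).
Proof.
have [_ _ IL _] := ideal_genP S.
rewrite [quot_scale]unlock; apply/alg_pi_eq; set u' := repr _.
have Iu : ideal_gen S (u - u') by apply/alg_pi_eq; rewrite alg_piK.
by rewrite -scalerBr -mulr_algl; exact: IL.
Qed.

Fact quot_mulA : associative quot_mul.
Proof.
elim/alg_pi_ind=> u; elim/alg_pi_ind=> v; elim/alg_pi_ind=> w.
by rewrite -!alg_pi_mul mulrA.
Qed.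

Fact quot_mul1r : left_id quot_one quot_mul.
Proof. by elim/alg_pi_ind=> u; rewrite -alg_pi_mul mul1r. Qed.

Fact quot_mulr1 : right_id quot_one quot_mul.
Proof. by elim/alg_pi_ind=> u; rewrite -alg_pi_mul mulr1. Qed.

Fact quot_mulDl : left_distributive quot_mul +%R.
Proof.
elim/alg_pi_ind=> u; elim/alg_pi_ind=> v; elim/alg_pi_ind=> w.
by rewrite -alg_piD -!alg_pi_mul mulrDl alg_piD.
Qed.

Fact quot_mulDr : right_distributive quot_mul +%R.
Proof.
elim/alg_pi_ind=> u; elim/alg_pi_ind=> v; elim/alg_pi_ind=> w.
by rewrite -alg_piD -!alg_pi_mul mulrDr alg_piD.
Qed.

HB.instance Definition _ := GRing.Zmodule_isPzRing.Build alg_quot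
  quot_mulA quot_mul1r quot_mulr1 quot_mulDl quot_mulDr.

Fact quot_scaleA a b x : quot_scale a (quot_scale b x) = quot_scale (a * b) x.
Proof. by elim/alg_pi_ind: x => u; rewrite -!alg_pi_scale scalerA. Qed.

Fact quot_scale1 : left_id 1 quot_scale.
Proof. by elim/alg_pi_ind=> u; rewrite -alg_pi_scale scale1r. Qed.

Fact quot_scaleDr : right_distributive quot_scale +%R.
Proof.
move=> a; elim/alg_pi_ind=> u; elim/alg_pi_ind=> v.
by rewrite -alg_piD -!alg_pi_scale scalerDr alg_piD.
Qed.

Fact quot_scaleDl x : {morph quot_scale^~ x : a b / a + b}.
Proof.
by elim/alg_pi_ind: x => u a b; rewrite -!alg_pi_scale scalerDl alg_piD.
Qed.

HB.instance Definition _ := GRing.Zmodule_isLmodule.Build K alg_quot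
  quot_scaleA quot_scale1 quot_scaleDr quot_scaleDl.

(* [alg_quot] may be the zero algebra, whereas [algType] requires [1 != 0]:
   it is only given its ring and module structures, and the next two lemmas
   say that they are compatible. *)
Lemma alg_quot_scalerAl (a : K) (x y : alg_quot) : a *: (x * y) = (a *: x) * y.
Proof.
elim/alg_pi_ind: x => u; elim/alg_pi_ind: y => v.
by rewrite /GRing.scale /GRing.mul/= -!(alg_pi_scale, alg_pi_mul) scalerAl.
Qed.

Lemma alg_quot_scalerAr (a : K) (x y : alg_quot) : a *: (x * y) = x * (a *: y).
Proof.
elim/alg_pi_ind: x => u; elim/alg_pi_ind: y => v.
by rewrite /GRing.scale /GRing.mul/= -!(alg_pi_scale, alg_pi_mul) scalerAr.
Qed.

Section Lift.
Variables (B : pzRingType) (f : {rmorphism A -> B}).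
Hypothesis fS : forall u, S u -> f u = 0.

Definition alg_lift of (forall u, S u -> f u = 0) :=
  fun x : alg_quot => f (repr x).

Lemma alg_lift_pi u : alg_lift fS (alg_pi u) = f u.
Proof.
apply/eqP; rewrite /alg_lift -subr_eq0 -rmorphB; apply/eqP.
have: ideal_gen S (repr (alg_pi u) - u) by apply/alg_pi_eq; rewrite alg_piK.
apply: (@ideal_gen_min A S [set v | f v = 0]) => //; split=> /=.
- exact: rmorph0.
- by move=> v w v0 w0; rewrite rmorphB v0 w0 subrr.
- by move=> v w w0; rewrite rmorphM w0 mulr0.
- by move=> v w v0; rewrite rmorphM v0 mul0r.
Qed.

Fact alg_lift_zmod_morphism : zmod_morphism (alg_lift fS).
Proof.
elim/alg_pi_ind=> u; elim/alg_pi_ind=> v.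
by rewrite -alg_piB !alg_lift_pi rmorphB.
Qed.

Fact alg_lift_monoid_morphism : monoid_morphism (alg_lift fS).
Proof.
split; first by rewrite alg_lift_pi rmorph1.
elim/alg_pi_ind=> u; elim/alg_pi_ind=> v.
by rewrite /GRing.mul/= -alg_pi_mul !alg_lift_pi rmorphM.
Qed.

HB.instance Definition _ := GRing.isZmodMorphism.Build alg_quot B
  (alg_lift fS) alg_lift_zmod_morphism.
HB.instance Definition _ := GRing.isMonoidMorphism.Build alg_quot B
  (alg_lift fS) alg_lift_monoid_morphism.

End Lift.

Lemma alg_quot_nontrivial (B : nzRingType) (f : {rmorphism A -> B}) :
  (forall u, S u -> f u = 0) -> (1 : alg_quot) != 0.
Proof.
move=> fS; apply: contra_neq (oner_neq0 B) => E.
by rewrite -(rmorph1 (alg_lift fS)) E rmorph0.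
Qed.

End AlgebraQuotient.

Section FreeAlgebra.
Variables (K : comNzRingType) (X : choiceType).

Definition free_alg : Type := {malg K[{fmonom X}]}.

HB.instance Definition _ := GRing.Lalgebra.on free_alg.

Fact free_alg_scalerAr (a : K) (u v : free_alg) : a *: (u * v) = u * (a *: v).
Proof.
rewrite [u * v]malgME [RHS](malgMEw (finmap.fsubset_refl _) (msuppZ_le a v)).
rewrite scaler_sumr; apply: eq_bigr => k _; rewrite scaler_sumr.
apply: eq_bigr => l _; apply/malgP => m.
by rewrite (mcoeffZ a << _ *g _ >>) 2!mcoeffU (mcoeffZ a v) mulrnAr mulrCA.
Qed.

HB.instance Definition _ := GRing.Lalgebra_isAlgebra.Build K free_alg
  free_alg_scalerAr.

Definition fgen (x : X) : free_alg := << fmu x >>.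

Definition free_aug : free_alg -> K := @mcoeff {fmonom X} K (@mone {fmonom X}).

HB.instance Definition _ := GRing.RMorphism.copy free_aug
  (@mcoeff {fmonom X} K (@mone {fmonom X})).

Lemma free_aug_gen x : free_aug (fgen x) = 0.
Proof. by rewrite /free_aug /fgen mcoeffU fm1_eq1. Qed.

End FreeAlgebra.

HB.mixin Record Lmodule_isLie (K : comNzRingType) L of GRing.Lmodule K L := {
  lie_br : L -> L -> L;
  lie_br_linearl : forall v (a : K) (u w : L),
    lie_br (a *: u + w) v = a *: lie_br u v + lie_br w v;
  lie_br_linearr : forall v (a : K) (u w : L),
    lie_br v (a *: u + w) = a *: lie_br v u + lie_br v w;
  lie_br_alt : forall u : L, lie_br u u = 0;
  lie_br_jacobi : forall u v w : L,
    lie_br u (lie_br v w) + lie_br v (lie_br w u) + lie_br w (lie_br u v) = 0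
}.

#[short(type="lieAlgType")]
HB.structure Definition LieAlgebra (K : comNzRingType) :=
  {L of GRing.Lmodule K L & Lmodule_isLie K L}.

(* T(V) is the free algebra on the underlying set of V, modulo the linearity
   of the inclusion of V. *)
Section TensorAlgebra.
Variables (K : comNzRingType) (V : lmodType K).

Definition tensor_rel : set (free_alg K V) :=
  [set r | exists (a : K) (u v : V),
    r = fgen K (a *: u + v) - (a *: fgen K u + fgen K v)].

Definition tensor_alg : Type := alg_quot tensor_rel.

HB.instance Definition _ := GRing.PzRing.on tensor_alg.
HB.instance Definition _ := GRing.Lmodule.on tensor_alg.

Fact tensor_aug_rel (r : free_alg K V) : tensor_rel r -> free_aug r = 0.
Proof.
move=> [a [u [v ->]]].
by rewrite rmorphB rmorphD -mulr_algl rmorphM /= !free_aug_gen mulr0 !addr0 subrr.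
Qed.

HB.instance Definition _ := GRing.PzSemiRing_isNonZero.Build tensor_alg
  (alg_quot_nontrivial tensor_aug_rel).
HB.instance Definition _ := GRing.Lmodule_isLalgebra.Build K tensor_alg
  (@alg_quot_scalerAl _ _ tensor_rel).
HB.instance Definition _ := GRing.Lalgebra_isAlgebra.Build K tensor_alg
  (@alg_quot_scalerAr _ _ tensor_rel).

Definition tensor_in (v : V) : tensor_alg := alg_pi tensor_rel (fgen K v).

Definition tensor_aug : tensor_alg -> K := alg_lift tensor_aug_rel.

HB.instance Definition _ := GRing.RMorphism.copy tensor_aug
  (alg_lift tensor_aug_rel).

Lemma tensor_aug_in v : tensor_aug (tensor_in v) = 0.
Proof. by rewrite /tensor_aug alg_lift_pi /= free_aug_gen. Qed.

End TensorAlgebra.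

Section UniversalEnveloping.
Variables (K : comNzRingType) (L : lieAlgType K).

Definition env_rel : set (tensor_alg L) :=
  [set r | exists u v : L,
    r = tensor_in u * tensor_in v - tensor_in v * tensor_in u
        - tensor_in (lie_br u v)].

Definition env_alg : Type := alg_quot env_rel.

HB.instance Definition _ := GRing.PzRing.on env_alg.
HB.instance Definition _ := GRing.Lmodule.on env_alg.

Fact env_aug_rel (r : tensor_alg L) : env_rel r -> tensor_aug r = 0.
Proof.
by move=> [u [v ->]]; rewrite 2!rmorphB (rmorphM _ (tensor_in u)) (rmorphM _ (tensor_in v)) /=
  !tensor_aug_in mulr0 !subr0.
Qed.

HB.instance Definition _ := GRing.PzSemiRing_isNonZero.Build env_alg
  (alg_quot_nontrivial env_aug_rel).
HB.instance Definition _ := GRing.Lmodule_isLalgebra.Build K env_alg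
  (@alg_quot_scalerAl _ _ env_rel).
HB.instance Definition _ := GRing.Lalgebra_isAlgebra.Build K env_alg
  (@alg_quot_scalerAr _ _ env_rel).

Definition env_in (v : L) : env_alg := alg_pi env_rel (tensor_in v).

End UniversalEnveloping.

(* The generators [inl i] and [inr i] stand for t_i and the partial derivative
   with respect to t_i. *)
Section WeylAlgebra.
Variables (K : comNzRingType) (n : nat).

Let t (i : 'I_n) : free_alg K ('I_n + 'I_n)%type := fgen K (inl i).
Let d (i : 'I_n) : free_alg K ('I_n + 'I_n)%type := fgen K (inr i).

Definition weyl_rel : set (free_alg K ('I_n + 'I_n)%type) :=
  [set r | exists i j : 'I_n,
    [\/ r = d i * d j - d j * d i,
        r = t i * t j - t j * t i |
        r = d i * t j - t j * d i - (i == j)%:R]].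

Definition weyl_alg : Type := alg_quot weyl_rel.

HB.instance Definition _ := GRing.PzRing.on weyl_alg.
HB.instance Definition _ := GRing.Lmodule.on weyl_alg.

Definition weyl_t (i : 'I_n) : weyl_alg := alg_pi weyl_rel (t i).
Definition weyl_d (i : 'I_n) : weyl_alg := alg_pi weyl_rel (d i).

End WeylAlgebra.

Variant schr_basis (n : nat) : Type :=
  | SE | SF | SH
  | SS of {ij : 'I_n * 'I_n | (ij.1 < ij.2)%N}
  | SX of 'I_n | SY of 'I_n | SZ.
Arguments SE {n}.
Arguments SF {n}.
Arguments SH {n}.
Arguments SZ {n}.

Section SchrBasis.
Variable n : nat.

Let code : Type :=
  (bool * bool + {ij : 'I_n * 'I_n | (ij.1 < ij.2)%N} + ('I_n + 'I_n))%type.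

Definition schr_encode (b : schr_basis n) : code :=
  match b with
  | SE => inl (inl (false, false)) | SF => inl (inl (false, true))
  | SH => inl (inl (true, false)) | SZ => inl (inl (true, true))
  | SS p => inl (inr p)
  | SX i => inr (inl i) | SY i => inr (inr i)
  end.

Definition schr_decode (c : code) : schr_basis n :=
  match c with
  | inl (inl (false, false)) => SE | inl (inl (false, true)) => SF
  | inl (inl (true, false)) => SH | inl (inl (true, true)) => SZ
  | inl (inr p) => SS p
  | inr (inl i) => SX i | inr (inr i) => SY i
  end.

Fact schr_encodeK : cancel schr_encode schr_decode.
Proof. by case. Qed.

HB.instance Definition _ := Finite.copy (schr_basis n) (can_type schr_encodeK).

Lemma schr_basis_eqE (b c : schr_basis n) :
  (b == c) = match b, c with
             | SE, SE | SF, SF | SH, SH | SZ, SZ => true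
             | SS p, SS q => p == q
             | SX i, SX j | SY i, SY j => i == j
             | _, _ => false
             end.
Proof. by case: b; case: c. Qed.

End SchrBasis.

Section Schrodinger.
Variables (K : comNzRingType) (n : nat).

Definition schrodinger : Type := {ffun schr_basis n -> K^o}.

HB.instance Definition _ := GRing.Lmodule.on schrodinger.

Definition schr_delta (b : schr_basis n) : schrodinger :=
  locked [ffun c => (c == b)%:R].

Lemma schr_deltaE b c : schr_delta b c = (c == b)%:R.
Proof. by rewrite /schr_delta -lock ffunE. Qed.

Definition schr_e : schrodinger := schr_delta SE.
Definition schr_f : schrodinger := schr_delta SF.
Definition schr_h : schrodinger := schr_delta SH.
Definition schr_z : schrodinger := schr_delta SZ.
Definition schr_x (i : 'I_n) : schrodinger := schr_delta (SX i).
Definition schr_y (i : 'I_n) : schrodinger := schr_delta (SY i).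

(* [insub (i, j)] is [Some] of the pair when [i < j] and [None] otherwise. *)
Definition schr_s_lt (i j : 'I_n) : schrodinger :=
  oapp (fun p => schr_delta (SS p)) 0 (insub (i, j)).
(* [s_ij] for arbitrary [i] and [j], with [s_ji = - s_ij] and [s_ii = 0]. *)
Definition schr_s (i j : 'I_n) : schrodinger := schr_s_lt i j - schr_s_lt j i.

Local Notation dl i j := ((i == j)%:R : K).
Local Notation e := schr_e.
Local Notation f := schr_f.
Local Notation h := schr_h.
Local Notation z := schr_z.
Local Notation x := schr_x.
Local Notation y := schr_y.
Local Notation s := schr_s.

Definition schr_table (b c : schr_basis n) : schrodinger :=
  match b, c with
  | SH, SE => 2 *: e           | SE, SH => - (2 *: e)
  | SH, SF => - (2 *: f)       | SF, SH => 2 *: f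
  | SE, SF => h                | SF, SE => - h
  | SX i, SY j => dl i j *: z  | SY j, SX i => - (dl i j *: z)
  | SH, SX i => x i            | SX i, SH => - x i
  | SH, SY i => - y i          | SY i, SH => y i
  | SE, SY i => x i            | SY i, SE => - x i
  | SF, SX i => y i            | SX i, SF => - y i
  | SS p, SX i => let: (k, l) := val p in dl l i *: x k - dl k i *: x l
  | SX i, SS p => let: (k, l) := val p in - (dl l i *: x k - dl k i *: x l)
  | SS p, SY i => let: (k, l) := val p in dl l i *: y k - dl k i *: y l
  | SY i, SS p => let: (k, l) := val p in - (dl l i *: y k - dl k i *: y l)
  | SS p, SS q => let: (i, j) := val p in let: (k, l) := val q in
      dl k j *: s i l + dl i l *: s j k + dl l j *: s k i + dl k i *: s l j
  | _, _ => 0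
  end.

Definition schr_br (u v : schrodinger) : schrodinger :=
  \sum_b \sum_c (u b * v c) *: schr_table b c.


Fact schr_br_linearl v : linear (schr_br^~ v).
Proof.
move=> a u w; rewrite /schr_br scaler_sumr -big_split; apply: eq_bigr => b _ /=.
rewrite scaler_sumr -big_split; apply: eq_bigr => c _ /=.
by rewrite !ffunE mulrDl scalerDl scalerA mulrA.
Qed.

Fact schr_br_linearr v : linear (schr_br v).
Proof.
move=> a u w; rewrite /schr_br scaler_sumr -big_split; apply: eq_bigr => b _ /=.
rewrite scaler_sumr -big_split; apply: eq_bigr => c _ /=.
by rewrite !ffunE mulrDr scalerDl scalerA mulrCA.
Qed.

Lemma schr_ext (u v : schrodinger) : (forall b, u b = v b) -> u = v.
Proof. by move=> uv; apply/(@ffunP _ (fun=> K^o)). Qed.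

Lemma schr_sumE (u : schrodinger) : u = \sum_b u b *: schr_delta b.
Proof.
apply: schr_ext => b; rewrite (@sum_ffunE _ K^o) (bigD1 b)//= ffunE schr_deltaE eqxx.
rewrite big1 ?addr0; first by rewrite /GRing.scale/= mulr1.
by move=> c /negPf cb; rewrite ffunE schr_deltaE eq_sym cb /GRing.scale/= mulr0.
Qed.

Lemma schr_br_delta b c : schr_br (schr_delta b) (schr_delta c) = schr_table b c.
Proof.
rewrite /schr_br (bigD1 b)//= (bigD1 c)//= !schr_deltaE !eqxx mulr1 scale1r.
rewrite !big1 ?addr0// => [d /negPf db|d /negPf dc].
  by rewrite big1// => ? _; rewrite !schr_deltaE db mul0r scale0r.
by rewrite !schr_deltaE dc mulr0 scale0r.
Qed.

Lemma schr_br_ext (W : lmodType K) (phi : {linear schrodinger -> W})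
    (B : schrodinger -> schrodinger -> W) :
  (forall v, linear (B^~ v)) -> (forall v, linear (B v)) ->
  (forall b c, phi (schr_table b c) = B (schr_delta b) (schr_delta c)) ->
  forall u v, phi (schr_br u v) = B u v.
Proof.
move=> Bl Br BE u v; rewrite /schr_br linear_sum.
have B0l w : B 0 w = 0.
  by have := Bl w 1 0 0; rewrite !scale1r addr0 => E; apply: (addrI (B 0 w)); rewrite addr0 -E.
have B0r w : B w 0 = 0.
  by have := Br w 1 0 0; rewrite !scale1r addr0 => E; apply: (addrI (B w 0)); rewrite addr0 -E.
have Suml (r : seq (schr_basis n)) w :
  B (\sum_(b <- r) u b *: schr_delta b) w = \sum_(b <- r) u b *: B (schr_delta b) w.
  by elim: r => [|b r IH]; rewrite ?big_nil// !big_cons Bl IH.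
have Sumr (r : seq (schr_basis n)) w :
  B w (\sum_(b <- r) v b *: schr_delta b) = \sum_(b <- r) v b *: B w (schr_delta b).
  by elim: r => [|b r IH]; rewrite ?big_nil// !big_cons Br IH.
rewrite [u in RHS]schr_sumE [v in RHS]schr_sumE Suml.
apply: eq_bigr => b _; rewrite Sumr scaler_sumr linear_sum.
by apply: eq_bigr => c _; rewrite linearZ BE scalerA.
Qed.

Definition schr_coord (b : schr_basis n) (u : schrodinger) : K^o := u b.
Definition schr_so (u : schrodinger) : 'M[K]_n :=
  \sum_p u (SS p) *: (delta_mx (val p).1 (val p).2 - delta_mx (val p).2 (val p).1).
Definition schr_xcol (u : schrodinger) : 'cV[K]_n := \col_i u (SX i).
Definition schr_ycol (u : schrodinger) : 'cV[K]_n := \col_i u (SY i).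

Fact schr_coord_linear b : linear (schr_coord b).
Proof. by move=> a u v; rewrite /schr_coord !ffunE. Qed.
HB.instance Definition _ b := GRing.isLinear.Build K schrodinger K^o *:%R
  (schr_coord b) (schr_coord_linear b).

Fact schr_so_linear : linear schr_so.
Proof.
move=> a u v; rewrite /schr_so scaler_sumr -big_split; apply: eq_bigr => p _ /=.
by rewrite !ffunE scalerDl scalerA.
Qed.
HB.instance Definition _ := GRing.isLinear.Build K schrodinger 'M_n *:%R
  schr_so schr_so_linear.

Fact schr_xcol_linear : linear schr_xcol.
Proof. by move=> a u v; apply/colP => i; rewrite !mxE !ffunE. Qed.
HB.instance Definition _ := GRing.isLinear.Build K schrodinger 'cV_n *:%R
  schr_xcol schr_xcol_linear.

Fact schr_ycol_linear : linear schr_ycol.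
Proof. by move=> a u v; apply/colP => i; rewrite !mxE !ffunE. Qed.
HB.instance Definition _ := GRing.isLinear.Build K schrodinger 'cV_n *:%R
  schr_ycol schr_ycol_linear.

Lemma schr_coord_delta b c : schr_coord b (schr_delta c) = (b == c)%:R.
Proof. by rewrite /schr_coord schr_deltaE. Qed.

Lemma schr_so_delta b : schr_so (schr_delta b) =
  if b is SS p then delta_mx (val p).1 (val p).2 - delta_mx (val p).2 (val p).1
  else 0.
Proof.
have H : (forall p, (SS p == b) = false) -> schr_so (schr_delta b) = 0.
  by move=> H; rewrite /schr_so big1// => p _; rewrite schr_deltaE H scale0r.
case: b H => [|||p|i|i|] => H; try by apply: H.
rewrite /schr_so (bigD1 p)//= schr_deltaE eqxx scale1r big1 ?addr0// => q /negPf qp.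
by rewrite schr_deltaE schr_basis_eqE qp scale0r.
Qed.

Lemma schr_xcol_delta b : schr_xcol (schr_delta b) =
  if b is SX i then delta_mx i 0 else 0.
Proof.
by case: b => *; apply/colP => j; rewrite !mxE schr_deltaE schr_basis_eqE ?andbT.
Qed.

Lemma schr_ycol_delta b : schr_ycol (schr_delta b) =
  if b is SY i then delta_mx i 0 else 0.
Proof.
by case: b => *; apply/colP => j; rewrite !mxE schr_deltaE schr_basis_eqE ?andbT.
Qed.

Lemma schr_so_s i j : schr_so (s i j) = delta_mx i j - delta_mx j i.
Proof.
rewrite /schr_s /schr_s_lt linearB /=.
case: insubP => [p _ pE|]; case: insubP => [q _ qE|] /=.
- by have := valP p; have := valP q; rewrite pE qE /= ltnNge => /negP ji /ltnW.
- by rewrite (linear0 schr_so) schr_so_delta pE subr0.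
- by rewrite (linear0 schr_so) schr_so_delta qE sub0r opprB.
- rewrite /= -!leqNgt => ji ij.
  have /val_inj -> : i = j :> nat by apply/eqP; rewrite eqn_leq ij ji.
  by rewrite !subrr.
Qed.

Lemma schr_s_other (W : lmodType K) (phi : {linear schrodinger -> W}) i j :
  (forall p, phi (schr_delta (SS p)) = 0) -> phi (s i j) = 0.
Proof.
move=> H; have H' i1 j1 : phi (schr_s_lt i1 j1) = 0.
  by rewrite /schr_s_lt; case: insubP => [p _ _|_] /=; [exact: H | exact: linear0].
by rewrite /schr_s (linearB phi) !H' subr0.
Qed.

Lemma schr_coord_s b i j : (forall p, (b == SS p) = false) ->
  schr_coord b (s i j) = 0.
Proof. by move=> H; apply: schr_s_other => p; rewrite /= schr_coord_delta H. Qed.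

Lemma schr_xcol_s i j : schr_xcol (s i j) = 0.
Proof. by apply: schr_s_other => p; rewrite /= schr_xcol_delta. Qed.

Lemma schr_ycol_s i j : schr_ycol (s i j) = 0.
Proof. by apply: schr_s_other => p; rewrite /= schr_ycol_delta. Qed.

Lemma schr_so_tr u : (schr_so u)^T = - schr_so u.
Proof.
rewrite /schr_so linear_sum -sumrN; apply: eq_bigr => p _.
by rewrite linearZ /= linearB /= !trmx_delta -scalerN opprB.
Qed.

Lemma schr_so_val u p : schr_so u (val p).1 (val p).2 = u (SS p).
Proof.
have ltp (q : {ij : 'I_n * 'I_n | (ij.1 < ij.2)%N}) := valP q.
have asym (q : {ij : 'I_n * 'I_n | (ij.1 < ij.2)%N}) :
  ((val p).1 == (val q).2) && ((val p).2 == (val q).1) = false.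
  apply/negP => /andP[/eqP E1 /eqP E2]; have := ltp q; rewrite -E1 -E2.
  by rewrite /= ltnNge (ltnW (ltp p)).
rewrite /schr_so summxE (bigD1 p)//= !mxE !eqxx asym subr0 mulr1.
rewrite big1 ?addr0// => q qp; rewrite !mxE asym subr0.
suff /negPf -> : ~~ (((val p).1 == (val q).1) && ((val p).2 == (val q).2)).
  by rewrite mulr0.
apply: contra qp => /andP[/eqP E1 /eqP E2]; apply/eqP/val_inj.
by rewrite [val q]surjective_pairing -E1 -E2 -surjective_pairing.
Qed.

Implicit Types u v w : schrodinger.

Lemma schr_coordD b u v : schr_coord b (u + v) = schr_coord b u + schr_coord b v.
Proof. exact: linearD. Qed.
Lemma schr_coordN b u : schr_coord b (- u) = - schr_coord b u.
Proof. exact: linearN. Qed.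
Lemma schr_coordZ b a u : schr_coord b (a *: u) = a * schr_coord b u.
Proof. exact: linearZ. Qed.
Lemma schr_coord0 b : schr_coord b (0 : schrodinger) = 0.
Proof. exact: linear0. Qed.
Lemma schr_soD u v : schr_so (u + v) = schr_so u + schr_so v.
Proof. exact: linearD. Qed.
Lemma schr_soN u : schr_so (- u) = - schr_so u.
Proof. exact: linearN. Qed.
Lemma schr_soZ a u : schr_so (a *: u) = a *: schr_so u.
Proof. exact: linearZ. Qed.
Lemma schr_so0 : schr_so (0 : schrodinger) = 0.
Proof. exact: linear0. Qed.
Lemma schr_xcolD u v : schr_xcol (u + v) = schr_xcol u + schr_xcol v.
Proof. exact: linearD. Qed.
Lemma schr_xcolN u : schr_xcol (- u) = - schr_xcol u.
Proof. exact: linearN. Qed.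
Lemma schr_xcolZ a u : schr_xcol (a *: u) = a *: schr_xcol u.
Proof. exact: linearZ. Qed.
Lemma schr_xcol0 : schr_xcol (0 : schrodinger) = 0.
Proof. exact: linear0. Qed.
Lemma schr_ycolD u v : schr_ycol (u + v) = schr_ycol u + schr_ycol v.
Proof. exact: linearD. Qed.
Lemma schr_ycolN u : schr_ycol (- u) = - schr_ycol u.
Proof. exact: linearN. Qed.
Lemma schr_ycolZ a u : schr_ycol (a *: u) = a *: schr_ycol u.
Proof. exact: linearZ. Qed.
Lemma schr_ycol0 : schr_ycol (0 : schrodinger) = 0.
Proof. exact: linear0. Qed.

(* [mxE] without the expansion of matrix products. *)
Fact mxaE m p :
  (forall (A B : 'M[K]_(m, p)) i j, (A + B) i j = A i j + B i j) *
  (forall (A : 'M[K]_(m, p)) i j, (- A) i j = - A i j) *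
  (forall a (A : 'M[K]_(m, p)) i j, (a *: A) i j = a * A i j) *
  (forall i j, (0 : 'M[K]_(m, p)) i j = 0).
Proof. by do !split=> *; rewrite mxE. Qed.

Fact trmx_pair (a b : 'cV[K]_n) : (a^T *m b) 0 0 = (b^T *m a) 0 0.
Proof.
have -> : b^T *m a = (a^T *m b)^T by rewrite trmx_mul trmxK.
by rewrite [RHS]mxE.
Qed.

Lemma schr_coord_inj u v :
  (forall b, match b with SE | SF | SH | SZ => true | _ => false end ->
    schr_coord b u = schr_coord b v) ->
  schr_so u = schr_so v -> schr_xcol u = schr_xcol v ->
  schr_ycol u = schr_ycol v -> u = v.
Proof.
move=> H Hs Hx Hy; apply: schr_ext => b.
case: b => [|||p|i|i|]; try exact: H.
- by rewrite -!schr_so_val Hs.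
- by have := congr1 (fun A : 'cV[K]_n => A i 0) Hx; rewrite !mxE.
- by have := congr1 (fun A : 'cV[K]_n => A i 0) Hy; rewrite !mxE.
Qed.

Ltac schr_norm :=
  repeat progress rewrite -> ?schr_coordD, ?schr_coordN, ?schr_coordZ, ?schr_coord0,
    ?schr_soD, ?schr_soN, ?schr_soZ, ?schr_so0,
    ?schr_xcolD, ?schr_xcolN, ?schr_xcolZ, ?schr_xcol0,
    ?schr_ycolD, ?schr_ycolN, ?schr_ycolZ, ?schr_ycol0.

Ltac schr_cases :=
  case=> [|||[[? ?] ?]|?|?|] [|||[[? ?] ?]|?|?|] /=;
  rewrite /schr_e /schr_f /schr_h /schr_z /schr_x /schr_y /=; schr_norm;
  repeat rewrite -> schr_coord_s by (by move=> ?; rewrite schr_basis_eqE);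
  rewrite -> ?schr_coord_delta, ?schr_basis_eqE, ?schr_so_delta, ?schr_so_s,
    ?schr_xcol_delta, ?schr_xcol_s, ?schr_ycol_delta, ?schr_ycol_s; rewrite /=.

Lemma schr_br_e u v : schr_coord SE (schr_br u v) =
  2 * (schr_coord SH u * schr_coord SE v - schr_coord SE u * schr_coord SH v).
Proof.
apply: (schr_br_ext (B := fun u v => 2 * (schr_coord SH u * schr_coord SE v
    - schr_coord SE u * schr_coord SH v) : K^o)).
- by move=> ? a ? ?; schr_norm; rewrite /GRing.scale /=; ring.
- by move=> ? a ? ?; schr_norm; rewrite /GRing.scale /=; ring.
by schr_cases; ring.
Qed.

Lemma schr_br_f u v : schr_coord SF (schr_br u v) =
  2 * (schr_coord SF u * schr_coord SH v - schr_coord SH u * schr_coord SF v).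
Proof.
apply: (schr_br_ext (B := fun u v => 2 * (schr_coord SF u * schr_coord SH v
    - schr_coord SH u * schr_coord SF v) : K^o)).
- by move=> ? a ? ?; schr_norm; rewrite /GRing.scale /=; ring.
- by move=> ? a ? ?; schr_norm; rewrite /GRing.scale /=; ring.
by schr_cases; ring.
Qed.

Lemma schr_br_h u v : schr_coord SH (schr_br u v) =
  schr_coord SE u * schr_coord SF v - schr_coord SF u * schr_coord SE v.
Proof.
apply: (schr_br_ext (B := fun u v => schr_coord SE u * schr_coord SF v
    - schr_coord SF u * schr_coord SE v : K^o)).
- by move=> ? a ? ?; schr_norm; rewrite /GRing.scale /=; ring.
- by move=> ? a ? ?; schr_norm; rewrite /GRing.scale /=; ring.
by schr_cases; ring.
Qed.

Lemma schr_br_z u v : schr_coord SZ (schr_br u v) =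
  ((schr_xcol u)^T *m schr_ycol v - (schr_ycol u)^T *m schr_xcol v) 0 0.
Proof.
apply: (schr_br_ext (B := fun u v =>
  ((schr_xcol u)^T *m schr_ycol v - (schr_ycol u)^T *m schr_xcol v) 0 0 : K^o)).
- move=> ? a ? ?; schr_norm; rewrite !linearP !mulmxDl -!scalemxAl.
  rewrite !mxE /GRing.scale /=; ring.
- move=> ? a ? ?; schr_norm; rewrite !mulmxDr -!scalemxAr.
  rewrite !mxE /GRing.scale /=; ring.
schr_cases; rewrite ?trmx0 ?mul0mx ?mulmx0 ?subr0 ?sub0r ?trmx_delta
  ?mul_delta_mx_cond -?[delta_mx _ _ *+ _]scaler_nat ?mxE; try ring.
- by rewrite !eqxx.
- by rewrite [in LHS]eq_sym !eqxx.
Qed.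

Lemma schr_br_x u v : schr_xcol (schr_br u v) =
  schr_so u *m schr_xcol v - schr_so v *m schr_xcol u
  + (schr_coord SH u *: schr_xcol v - schr_coord SH v *: schr_xcol u)
  + (schr_coord SE u *: schr_ycol v - schr_coord SE v *: schr_ycol u).
Proof.
apply: (schr_br_ext (B := fun u v =>
  schr_so u *m schr_xcol v - schr_so v *m schr_xcol u
  + (schr_coord SH u *: schr_xcol v - schr_coord SH v *: schr_xcol u)
  + (schr_coord SE u *: schr_ycol v - schr_coord SE v *: schr_ycol u))).
- move=> v1 a u1 w1; schr_norm; rewrite !mulmxDl !mulmxDr -!scalemxAl -!scalemxAr.
  by apply/matrixP => r c; rewrite !mxaE; ring.
- move=> v1 a u1 w1; schr_norm; rewrite !mulmxDl !mulmxDr -!scalemxAl -!scalemxAr.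
  by apply/matrixP => r c; rewrite !mxaE; ring.
schr_cases; rewrite ?mul0mx ?mulmx0 ?mulmxBl ?mulmxBr ?mul_delta_mx_cond -?[delta_mx _ _ *+ _]scaler_nat.
all: rewrite ?(scale0r, scaler0, scale1r) ?(subr0, sub0r, addr0, add0r, oppr0) //.
all: by apply/matrixP => r c; rewrite ?mxE; ring.
Qed.

Lemma schr_br_y u v : schr_ycol (schr_br u v) =
  schr_so u *m schr_ycol v - schr_so v *m schr_ycol u
  - (schr_coord SH u *: schr_ycol v - schr_coord SH v *: schr_ycol u)
  + (schr_coord SF u *: schr_xcol v - schr_coord SF v *: schr_xcol u).
Proof.
apply: (schr_br_ext (B := fun u v =>
  schr_so u *m schr_ycol v - schr_so v *m schr_ycol u
  - (schr_coord SH u *: schr_ycol v - schr_coord SH v *: schr_ycol u)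
  + (schr_coord SF u *: schr_xcol v - schr_coord SF v *: schr_xcol u))).
- move=> v1 a u1 w1; schr_norm; rewrite !mulmxDl !mulmxDr -!scalemxAl -!scalemxAr.
  by apply/matrixP => r c; rewrite !mxaE; ring.
- move=> v1 a u1 w1; schr_norm; rewrite !mulmxDl !mulmxDr -!scalemxAl -!scalemxAr.
  by apply/matrixP => r c; rewrite !mxaE; ring.
schr_cases; rewrite ?mul0mx ?mulmx0 ?mulmxBl ?mulmxBr ?mul_delta_mx_cond -?[delta_mx _ _ *+ _]scaler_nat.
all: rewrite ?(scale0r, scaler0, scale1r) ?(subr0, sub0r, addr0, add0r, oppr0) //.
all: by apply/matrixP => r c; rewrite ?mxE; ring.
Qed.

Fact schr_so_comm (i j k l : 'I_n) :
  let sm (a b : 'I_n) : 'M[K]_n := delta_mx a b - delta_mx b a in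
  dl k j *: sm i l + dl i l *: sm j k + dl l j *: sm k i + dl k i *: sm l j =
  sm i j *m sm k l - sm k l *m sm i j.
Proof.
rewrite /= !mulmxBl !mulmxBr !mul_delta_mx_cond -!scaler_nat.
rewrite (eq_sym j k) (eq_sym j l) (eq_sym i k) (eq_sym l i).
by apply/matrixP => r c; rewrite !mxE; ring.
Qed.

Lemma schr_br_so u v : schr_so (schr_br u v) =
  schr_so u *m schr_so v - schr_so v *m schr_so u.
Proof.
apply: (schr_br_ext (B := fun u v =>
  schr_so u *m schr_so v - schr_so v *m schr_so u)).
- move=> v1 a u1 w1; schr_norm; rewrite !mulmxDl !mulmxDr -!scalemxAl -!scalemxAr.
  by apply/matrixP => r c; rewrite !mxaE; ring.
- move=> v1 a u1 w1; schr_norm; rewrite !mulmxDl !mulmxDr -!scalemxAl -!scalemxAr.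
  by apply/matrixP => r c; rewrite !mxaE; ring.
schr_cases; rewrite ?mul0mx ?mulmx0 ?subrr ?scaler0 ?(subr0, oppr0) //.
exact: schr_so_comm.
Qed.

Fact schr_br_alt u : schr_br u u = 0.
Proof.
apply: schr_coord_inj => [b|||]; schr_norm.
- case: b => [|||p|i|i|] //= _; rewrite ?schr_br_e ?schr_br_f ?schr_br_h ?schr_br_z.
  + by ring.
  + by ring.
  + by ring.
  by rewrite !mxaE trmx_pair subrr.
- by rewrite schr_br_so subrr.
- by rewrite schr_br_x !subrr !addr0.
- by rewrite schr_br_y !subrr !addr0.
Qed.

Fact schr_br_jacobi u v w :
  schr_br u (schr_br v w) + schr_br v (schr_br w u) + schr_br w (schr_br u v) = 0.
Proof.
apply: schr_coord_inj => [b|||]; schr_norm.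
- case: b => [|||p|i|i|] //= _.
  + by rewrite !(schr_br_e, schr_br_f, schr_br_h); ring.
  + by rewrite !(schr_br_e, schr_br_f, schr_br_h); ring.
  + by rewrite !(schr_br_e, schr_br_f, schr_br_h); ring.
  rewrite !(schr_br_z, schr_br_x, schr_br_y) !mulmxDr !mulmxN -!scalemxAr.
  rewrite !mulmxBr -!scalemxAr !mxaE.
  have yx a b : ((schr_ycol a)^T *m schr_xcol b) 0 0 =
      ((schr_xcol b)^T *m schr_ycol a) 0 0 by exact: trmx_pair.
  have ysx a b c : ((schr_ycol a)^T *m (schr_so b *m schr_xcol c)) 0 0 =
      - ((schr_xcol c)^T *m (schr_so b *m schr_ycol a)) 0 0.
    by rewrite trmx_pair trmx_mul schr_so_tr -mulmxA mulNmx mulmxN mxaE.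
  rewrite !yx !ysx.
  rewrite (trmx_pair (schr_xcol v) (schr_xcol u)).
  rewrite (trmx_pair (schr_xcol w) (schr_xcol u)).
  rewrite (trmx_pair (schr_xcol w) (schr_xcol v)).
  rewrite (trmx_pair (schr_ycol v) (schr_ycol u)).
  rewrite (trmx_pair (schr_ycol w) (schr_ycol u)).
  rewrite (trmx_pair (schr_ycol w) (schr_ycol v)).
  by ring.
- rewrite !schr_br_so !mulmxBl !mulmxBr !mulmxA.
  by apply/matrixP => r c; rewrite !mxaE; ring.
- rewrite !(schr_br_e, schr_br_h, schr_br_x, schr_br_y, schr_br_so).
  rewrite !(mulmxBl, mulmxBr, mulmxDr, mulmxN) -!scalemxAr !mulmxA.
  by apply/matrixP => r c; rewrite !mxaE; ring.
- rewrite !(schr_br_f, schr_br_h, schr_br_x, schr_br_y, schr_br_so).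
  rewrite !(mulmxBl, mulmxBr, mulmxDr, mulmxN) -!scalemxAr !mulmxA.
  by apply/matrixP => r c; rewrite !mxaE; ring.
Qed.

HB.instance Definition _ := Lmodule_isLie.Build K schrodinger
  schr_br_linearl schr_br_linearr schr_br_alt schr_br_jacobi.

End Schrodinger.

Section CentralQuotient.
Variables (K : comNzRingType) (n : nat) (zdot : K).

Definition schr_central_rel : set (env_alg (schrodinger K n)) :=
  [set env_in (schr_z K n) - zdot%:A].

Definition schr_env_quot : Type := alg_quot schr_central_rel.

HB.instance Definition _ := GRing.PzRing.on schr_env_quot.
HB.instance Definition _ := GRing.Lmodule.on schr_env_quot.

Definition schr_in (u : schrodinger K n) : schr_env_quot :=
  alg_pi schr_central_rel (env_in u).

End CentralQuotient.

(* Main.v *)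
Require Import Defs.
From HB Require Import structures.
From mathcomp Require Import all_boot all_order all_algebra.
From mathcomp Require Import reals complex.
From mathcomp Require Import monalg.

Set Implicit Arguments.
Unset Strict Implicit.
Unset Printing Implicit Defensive.

Import GRing.Theory.
Local Open Scope ring_scope.

(* By the universal property of the enveloping algebra it is enough to check
   that the proposed images satisfy the brackets of the Schrodinger algebra.
   The images of e, f, h and s_ij are quadratic in t and d, so commutation with
   them is a derivation which maps the span of the t_i and d_i to itself; the
   brackets of two quadratic elements follow from this linear action by the
   Leibniz rule. *)

(** * Universal property of the free algebra *)

Section FreeAlgebraLift.
Variables (K : comNzRingType) (X : choiceType) (A : algType K) (h : X -> A).

Definition word_eval (m : {fmonom X}) : A := \prod_(x <- m) h x.

Fact word_eval_mmorphism : mmorphism word_eval.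
Proof.
split=> [m p|]; rewrite /word_eval; first by rewrite fmM big_cat.
by rewrite fm1 big_nil.
Qed.

HB.instance Definition _ :=
  isMultiplicative.Build {fmonom X} A word_eval word_eval_mmorphism.

(** The free algebra is the monoid algebra of words, so a map on letters extends multiplicatively to
    words and then linearly to combinations of words. *)
Definition free_lift : free_alg K X -> A := mmap (in_alg A) word_eval.

Lemma free_lift_gen x : free_lift (fgen K x) = h x.
Proof. by rewrite /free_lift mmapU /= scale1r mul1r /word_eval fmU big_seq1. Qed.

Fact free_lift_linear : linear free_lift.
Proof. by move=> a u v; rewrite /free_lift raddfD /= mmapZ mulr_algl. Qed.

HB.instance Definition _ := GRing.isLinear.Build K (free_alg K X) A *:%R
  free_lift free_lift_linear.

Fact free_lift_monoid_morphism : monoid_morphism free_lift.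
Proof.
have [|fM f1] := @commr_mmap_is_multiplicative _ _ _ (in_alg A) word_eval.
  (* Multiplicativity requires the images of coefficients to commute with the values of words;
     scalars are central in [A]. *)
  by move=> g m m'; rewrite /GRing.comm /= mulr_algl mulr_algr.
by split.
Qed.

HB.instance Definition _ := GRing.isMonoidMorphism.Build (free_alg K X) A
  free_lift free_lift_monoid_morphism.

End FreeAlgebraLift.

(** * Linearity of projections to quotients and of induced maps *)

Section AlgebraQuotientMaps.
Variables (K : comNzRingType) (A : algType K) (S : classical_sets.set A).

Fact alg_pi_linear : linear (alg_pi S).
Proof. by move=> a u v; rewrite alg_piD alg_pi_scale. Qed.

HB.instance Definition _ := GRing.isLinear.Build K A (alg_quot S) *:%R
  (alg_pi S) alg_pi_linear.

Fact alg_pi_monoid_morphism : monoid_morphism (alg_pi S).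
Proof. by split=> // u v; rewrite alg_pi_mul. Qed.

HB.instance Definition _ := GRing.isMonoidMorphism.Build A (alg_quot S)
  (alg_pi S) alg_pi_monoid_morphism.

(** [alg_lift] is built as a ring morphism only. Compatibility with scalars descends from [f]
    because every class is the image of a representative under the linear map [alg_pi]. *)
Lemma alg_lift_scalable (B : algType K) (T : classical_sets.set B)
    (f : {rmorphism A -> alg_quot T}) (fS : forall u, S u -> f u = 0) :
  scalable f -> scalable (alg_lift fS).
Proof.
move=> fZ a; elim/alg_pi_ind=> u.
by rewrite -linearZ !alg_lift_pi fZ.
Qed.

End AlgebraQuotientMaps.

(** * Universal property of the enveloping algebra *)

Section EnvelopingLift.
Variables (K : comNzRingType) (L : lieAlgType K) (A : algType K).
Variables (S : classical_sets.set A) (f : {linear L -> alg_quot S}).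
Hypothesis f_lie : forall u v, f (lie_br u v) = f u * f v - f v * f u.

(* [A] is nontrivial while [alg_quot S] may be zero, so the lift is built on
   representatives in [A], to which the universal property of the free algebra
   applies. *)
Let f_free : {rmorphism free_alg K L -> alg_quot S} :=
  alg_pi S \o free_lift (fun u => repr (f u)).

Let f_free_gen u : f_free (fgen K u) = f u.
Proof. by rewrite /= free_lift_gen alg_piK. Qed.

Let f_free_scalable : scalable f_free.
Proof. by move=> a u; rewrite /= !linearZ. Qed.

Let f_free_rel r : tensor_rel r -> f_free r = 0.
Proof.
move=> [a [u [v ->]]].
by rewrite rmorphB rmorphD f_free_scalable !f_free_gen linearP subrr.
Qed.

Let f_tensor : {rmorphism tensor_alg L -> alg_quot S} := alg_lift f_free_rel.

Let f_tensor_in u : f_tensor (tensor_in u) = f u.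
Proof. by rewrite [LHS]alg_lift_pi f_free_gen. Qed.

Let f_tensor_rel r : env_rel r -> f_tensor r = 0.
Proof.
move=> [u [v ->]].
by rewrite !rmorphB !(rmorphM f_tensor) !f_tensor_in f_lie subrr.
Qed.

Lemma env_lift : exists2 g : {rmorphism env_alg L -> alg_quot S},
  scalable g & forall u, g (env_in u) = f u.
Proof.
exists (alg_lift f_tensor_rel).
  (* One application for each nested quotient: first the bracket relations, then the linearity
     relations of the tensor algebra. *)
  by apply: alg_lift_scalable; apply: alg_lift_scalable.
by move=> u; rewrite [LHS]alg_lift_pi f_tensor_in.
Qed.

End EnvelopingLift.

(** * Commutator calculus in a ring *)

Section Commutator.
Variable B : pzRingType.
Implicit Types a b c : B.

Definition commutator a b : B := a * b - b * a.

Lemma commutatorC a b : commutator a b = - commutator b a.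
Proof. by rewrite /commutator opprB. Qed.

Fact commutator_zmod_morphism a : zmod_morphism (commutator a).
Proof.
move=> b c; rewrite /commutator mulrBr mulrBl !opprB !addrA.
by rewrite [LHS](ACl (1*4*3*2)).
Qed.

HB.instance Definition _ a := GRing.isZmodMorphism.Build B B (commutator a)
  (commutator_zmod_morphism a).

Lemma commutatorBl a b c : commutator (a - b) c = commutator a c - commutator b c.
Proof.
rewrite /commutator mulrBr mulrBl !opprB !addrA.
by rewrite [LHS](ACl (1*4*3*2)).
Qed.

Lemma commutatorDl a b c : commutator (a + b) c = commutator a c + commutator b c.
Proof. by rewrite /commutator mulrDl mulrDr opprD addrACA. Qed.

Lemma commutatorNr a b : commutator a (- b) = - commutator a b.
Proof. exact: raddfN. Qed.

Lemma commutatorNl a b : commutator (- a) b = - commutator a b.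
Proof. by rewrite commutatorC commutatorNr -commutatorC. Qed.

(** Leibniz rule: the two occurrences of [b * a * c] cancel. *)
Lemma commutatorMr a b c :
  commutator a (b * c) = commutator a b * c + b * commutator a c.
Proof. by rewrite /commutator mulrBl mulrBr !mulrA addrA subrK. Qed.

Lemma commutatorMl a b c :
  commutator (a * b) c = a * commutator b c + commutator a c * b.
Proof.
rewrite commutatorC commutatorMr opprD [commutator b c]commutatorC.
by rewrite [commutator a c]commutatorC mulrN mulNr addrC.
Qed.

Lemma commutator_suml (I : Type) (r : seq I) (P : pred I) (F : I -> B) c :
  commutator (\sum_(k <- r | P k) F k) c = \sum_(k <- r | P k) commutator (F k) c.
Proof.
rewrite commutatorC (raddf_sum (commutator c)) -sumrN; apply: eq_bigr => k _.
by rewrite -commutatorC.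
Qed.

End Commutator.

(** Used from right to left, this turns a single term into a sum over [k], so that identities
    between sums can be checked termwise. *)
Lemma sumr_delta (V : zmodType) (n : nat) (i : 'I_n) (F : 'I_n -> V) :
  \sum_k F k *+ (i == k) = F i.
Proof.
rewrite (bigD1 i)//= eqxx big1 ?addr0 // => k ki.
by rewrite eq_sym (negPf ki).
Qed.

(** * Commutators of quadratic elements in the canonical commutation relations *)

Section OscillatorCommutators.
Variables (B : pzRingType) (n : nat) (t d : 'I_n -> B).
Hypothesis commutator_dd : forall i j, commutator (d i) (d j) = 0.
Hypothesis commutator_tt : forall i j, commutator (t i) (t j) = 0.
Hypothesis commutator_dt : forall i j, commutator (d i) (t j) = (i == j)%:R.

Let commutator_td i j : commutator (t i) (d j) = - (j == i)%:R.
Proof. by rewrite commutatorC commutator_dt. Qed.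

(** The factors one half and the signs are postponed to [schr_gen], so that these computations
    involve only integer multiples and hold in any ring. *)
Definition osc_e : B := \sum_(k < n) d k ^+ 2.
Definition osc_f : B := \sum_(k < n) t k ^+ 2.
Definition osc_h : B := \sum_(k < n) (d k * t k + t k * d k).
Definition osc_s (i j : 'I_n) : B := t i * d j - t j * d i.

Lemma osc_sC i j : osc_s i j = - osc_s j i.
Proof. by rewrite /osc_s opprB. Qed.

Lemma commutator_ed i : commutator osc_e (d i) = 0.
Proof.
rewrite commutator_suml big1 // => k _.
by rewrite commutatorMl commutator_dd mulr0 mul0r addr0.
Qed.

Lemma commutator_et i : commutator osc_e (t i) = d i *+ 2.
Proof.
rewrite commutator_suml -(sumr_delta i (fun k => d k *+ 2)).
apply: eq_bigr => k _; rewrite commutatorMl commutator_dt mulr_natr mulr_natl.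
by rewrite eq_sym -mulr2n mulrnAC.
Qed.

Lemma commutator_ft i : commutator osc_f (t i) = 0.
Proof.
rewrite commutator_suml big1 // => k _.
by rewrite commutatorMl commutator_tt mulr0 mul0r addr0.
Qed.

Lemma commutator_fd i : commutator osc_f (d i) = - (t i *+ 2).
Proof.
rewrite commutator_suml -(sumr_delta i (fun k => t k *+ 2)) -sumrN.
apply: eq_bigr => k _; rewrite commutatorMl commutator_td mulrN mulNr.
by rewrite mulr_natr mulr_natl -opprD -mulr2n mulrnAC.
Qed.

(** Each of the two orderings [d k * t k] and [t k * d k] contributes one copy of [t i] when [k] is
    [i]. *)
Lemma commutator_ht i : commutator osc_h (t i) = t i *+ 2.
Proof.
rewrite commutator_suml -(sumr_delta i (fun k => t k *+ 2)).
apply: eq_bigr => k _; rewrite commutatorDl !commutatorMl commutator_dt commutator_tt.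
by rewrite mulr0 mul0r add0r addr0 mulr_natr mulr_natl eq_sym -mulr2n mulrnAC.
Qed.

Lemma commutator_hd i : commutator osc_h (d i) = - (d i *+ 2).
Proof.
rewrite commutator_suml -(sumr_delta i (fun k => d k *+ 2)) -sumrN.
apply: eq_bigr => k _; rewrite commutatorDl !commutatorMl commutator_td commutator_dd.
rewrite mulr0 mul0r add0r addr0 mulrN mulNr mulr_natr mulr_natl -opprD.
by rewrite -mulr2n mulrnAC.
Qed.

(** Only the [d] factors fail to commute with [t k]. Together with [commutator_sd] this shows that
    the [t] and the [d] transform under the same infinitesimal rotation. *)
Lemma commutator_st i j k :
  commutator (osc_s i j) (t k) = t i *+ (j == k) - t j *+ (i == k).
Proof.
rewrite commutatorBl !commutatorMl !commutator_tt !commutator_dt.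
by rewrite !mul0r !addr0 !mulr_natr.
Qed.

Lemma commutator_sd i j k :
  commutator (osc_s i j) (d k) = d i *+ (j == k) - d j *+ (i == k).
Proof.
rewrite commutatorBl !commutatorMl !commutator_dd !commutator_td.
by rewrite !mulr0 !add0r !mulNr opprK !mulr_natl addrC !(eq_sym k).
Qed.

Lemma commutator_ef : commutator osc_e osc_f = osc_h *+ 2.
Proof.
rewrite (raddf_sum (commutator _)) -sumrMnl; apply: eq_bigr => k _ /=.
by rewrite commutatorMr commutator_et mulrnAl mulrnAr mulrnDl.
Qed.

(** Each [d k] has weight -2 under commutation with [osc_h], so its square has weight -4. *)
Lemma commutator_he : commutator osc_h osc_e = - (osc_e *+ 4).
Proof.
rewrite (raddf_sum (commutator _)) -sumrMnl -sumrN; apply: eq_bigr => k _ /=.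
rewrite commutatorMr commutator_hd mulNr mulrN mulrnAl mulrnAr -expr2 -opprD.
by rewrite -mulrnDr.
Qed.

Lemma commutator_hf : commutator osc_h osc_f = osc_f *+ 4.
Proof.
rewrite (raddf_sum (commutator _)) -sumrMnl; apply: eq_bigr => k _ /=.
by rewrite commutatorMr commutator_ht mulrnAl mulrnAr -expr2 -mulrnDr.
Qed.

(** Rotation invariance of a sum of squares: after the Leibniz rule the Kronecker deltas leave four
    products of [d i] and [d j], which cancel in pairs. *)
Lemma commutator_se i j : commutator (osc_s i j) osc_e = 0.
Proof.
rewrite (raddf_sum (commutator _)) (eq_bigr (fun k => ((d i * d k) *+ (j == k) - (d j * d k) *+ (i == k))
   + ((d k * d i) *+ (j == k) - (d k * d j) *+ (i == k)))) => [|k _].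
  rewrite big_split !sumrB /= !sumr_delta.
  by rewrite addrC addrA subrK subrr.
by rewrite /= commutatorMr commutator_sd mulrBl mulrBr !mulrnAl !mulrnAr.
Qed.

Lemma commutator_sf i j : commutator (osc_s i j) osc_f = 0.
Proof.
rewrite (raddf_sum (commutator _)) (eq_bigr (fun k => ((t i * t k) *+ (j == k) - (t j * t k) *+ (i == k))
   + ((t k * t i) *+ (j == k) - (t k * t j) *+ (i == k)))) => [|k _].
  rewrite big_split !sumrB /= !sumr_delta.
  by rewrite addrC addrA subrK subrr.
by rewrite /= commutatorMr commutator_st mulrBl mulrBr !mulrnAl !mulrnAr.
Qed.

Lemma commutator_sh i j : commutator (osc_s i j) osc_h = 0.
Proof.
rewrite (raddf_sum (commutator _)) (eq_bigr (fun k =>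
     (((d i * t k) *+ (j == k) - (d j * t k) *+ (i == k))
   + ((d k * t i) *+ (j == k) - (d k * t j) *+ (i == k)))
   + (((t i * d k) *+ (j == k) - (t j * d k) *+ (i == k))
   + ((t k * d i) *+ (j == k) - (t k * d j) *+ (i == k))))) => [|k _].
  rewrite !big_split /= !sumrN !sumr_delta !addrA !subrK.
  by rewrite subrr add0r subrr.
rewrite (raddfD (commutator _)) /= !commutatorMr commutator_st commutator_sd.
by rewrite !mulrBl !mulrBr !mulrnAl !mulrnAr.
Qed.

Lemma commutator_ss i j k l : commutator (osc_s i j) (osc_s k l) =
  osc_s i l *+ (k == j) + osc_s j k *+ (i == l)
  + osc_s k i *+ (l == j) + osc_s l j *+ (k == i).
Proof.
rewrite (raddfB (commutator _)) /= !commutatorMr !commutator_st !commutator_sd.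
rewrite !mulrBl !mulrBr !mulrnAl !mulrnAr.
rewrite !mulrnBl (eq_sym k j) (eq_sym l j) (eq_sym k i).
rewrite !opprD !opprK !addrA.
(* The permutation pairs the eight monomials into the four expanded [osc_s] of the right-hand
   side. *)
by rewrite [LHS](ACl (1*7*6*4*3*5*8*2)).
Qed.

End OscillatorCommutators.

(** * Canonical commutation relations in the Weyl algebra *)

Section WeylRelations.
Variables (K : comNzRingType) (n : nat).

Lemma weyl_commutator_dd (i j : 'I_n) : commutator (weyl_d K i) (weyl_d K j) = 0.
Proof.
apply/eqP; rewrite subr_eq0; apply/eqP.
rewrite -[LHS](rmorphM (alg_pi _)) -[RHS](rmorphM (alg_pi _)).
by apply/alg_pi_eq; apply: sub_ideal_gen; exists i, j; constructor 1.
Qed.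

Lemma weyl_commutator_tt (i j : 'I_n) : commutator (weyl_t K i) (weyl_t K j) = 0.
Proof.
apply/eqP; rewrite subr_eq0; apply/eqP.
rewrite -[LHS](rmorphM (alg_pi _)) -[RHS](rmorphM (alg_pi _)).
by apply/alg_pi_eq; apply: sub_ideal_gen; exists i, j; constructor 2.
Qed.

Lemma weyl_commutator_dt (i j : 'I_n) :
  commutator (weyl_d K i) (weyl_t K j) = (i == j)%:R.
Proof.
rewrite -[RHS](rmorph_nat (alg_pi _)) /commutator.
rewrite -[X in X - _](rmorphM (alg_pi _)) -[X in _ - X](rmorphM (alg_pi _)).
rewrite -[LHS](rmorphB (alg_pi _)).
by apply/alg_pi_eq; apply: sub_ideal_gen; exists i, j; constructor 3.
Qed.

Lemma weyl_commutatorZl (a : K) (u v : weyl_alg K n) :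
  commutator (a *: u) v = a *: commutator u v.
Proof.
by rewrite /commutator scalerBr [in RHS]alg_quot_scalerAl [in RHS]alg_quot_scalerAr.
Qed.

Lemma weyl_commutatorZr (a : K) (u v : weyl_alg K n) :
  commutator u (a *: v) = a *: commutator u v.
Proof. by rewrite commutatorC weyl_commutatorZl -scalerN -commutatorC. Qed.

End WeylRelations.

(** * The oscillator representation of the Schrodinger algebra *)

Section OscillatorRepresentation.
Variables (K : fieldType) (n : nat) (zdot sq : K).
Hypotheses (two_neq0 : (2 : K) != 0) (sqE : sq ^+ 2 = zdot).

Local Notation W := (weyl_alg K n).
Local Notation t := (@weyl_t K n).
Local Notation d := (@weyl_d K n).

(** The factor [sq] is shared by [SX] and [SY], so that the commutator of a conjugate pair is
    [sq ^+ 2], the scalar assigned to [SZ]. *)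
Definition schr_gen (b : schr_basis n) : W :=
  match b with
  | SE => 2^-1 *: osc_e d
  | SF => - (2^-1 *: osc_f t)
  | SH => - (2^-1 *: osc_h t d)
  | SS p => osc_s t d (val p).1 (val p).2
  | SX i => sq *: d i
  | SY i => sq *: t i
  | SZ => zdot *: (1 : W)
  end.

Definition schr_rep (u : schrodinger K n) : W := \sum_b u b *: schr_gen b.

Fact schr_rep_linear : linear schr_rep.
Proof.
move=> a u v; rewrite /schr_rep scaler_sumr -big_split; apply: eq_bigr => b _ /=.
by rewrite !ffunE scalerDl scalerA.
Qed.

HB.instance Definition _ := GRing.isLinear.Build K (schrodinger K n) W *:%R
  schr_rep schr_rep_linear.

Lemma schr_rep_delta b : schr_rep (schr_delta K b) = schr_gen b.
Proof.
rewrite /schr_rep (bigD1 b)//= schr_deltaE eqxx scale1r big1 ?addr0// => c /negPf cb.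
by rewrite schr_deltaE cb scale0r.
Qed.

Lemma schr_rep_s i j : schr_rep (schr_s K i j) = osc_s t d i j.
Proof.
rewrite /schr_s /schr_s_lt linearB /=.
case: insubP => [p _ pE|]; case: insubP => [q _ qE|] /=.
- by have := valP p; have := valP q; rewrite pE qE /= ltnNge => /negP ji /ltnW.
- by rewrite (linear0 schr_rep) schr_rep_delta /= pE subr0.
- by rewrite (linear0 schr_rep) schr_rep_delta /= qE sub0r osc_sC opprK.
(* Neither index is smaller than the other, so they coincide and both sides vanish. *)
- rewrite /= -!leqNgt => ji ij.
  have /val_inj -> : i = j :> nat by apply/eqP; rewrite eqn_leq ij ji.
  by rewrite /osc_s !subrr.
Qed.

Let dd := @weyl_commutator_dd K n.
Let tt := @weyl_commutator_tt K n.
Let dt := @weyl_commutator_dt K n.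

Let table_spec b c :=
  schr_rep (schr_table K b c) = commutator (schr_gen b) (schr_gen c).

(** Both sides are antisymmetric, so each pair of basis elements has to be checked in one order
    only. *)
Let tableC b c : table_spec b c -> table_spec c b.
Proof.
rewrite /table_spec => tbc; rewrite [RHS]commutatorC -tbc -raddfN -!schr_br_delta /=.
congr schr_rep; apply/eqP; rewrite -addr_eq0.
set u := schr_delta K b; set v := schr_delta K c.
(* Polarisation: expanding the vanishing bracket of [u + v] with itself leaves the sum of the two
   mixed brackets. *)
have := schr_br_alt (u + v).
have := schr_br_linearl (u + v) 1 u v; rewrite !scale1r => ->.
have := schr_br_linearr u 1 u v; rewrite !scale1r => ->.
have := schr_br_linearr v 1 u v; rewrite !scale1r => ->.
by rewrite !schr_br_alt add0r addr0 addrC => ->.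
Qed.

(** The basis is treated in the order s, z, h, e, f, x, y; pairs met earlier are recovered, through
    [tableC] where the order is reversed. *)
Let table_s p c : table_spec (SS p) c.
Proof.
rewrite /table_spec; case: p => [[i j] ij] /=.
case: c => [|||[[k l] kl]|k|k|] /=; rewrite ?(linear0 schr_rep).
- by rewrite weyl_commutatorZr commutator_se // scaler0.
- by rewrite commutatorNr weyl_commutatorZr commutator_sf // scaler0 oppr0.
- by rewrite commutatorNr weyl_commutatorZr commutator_sh // scaler0 oppr0.
- rewrite 3!linearD !linearZ /= !schr_rep_s !scaler_nat commutator_ss //.
- rewrite linearB !linearZ /= !schr_rep_delta /= weyl_commutatorZr commutator_sd //.
  by rewrite scalerBr !scaler_nat !mulNrn !scalerMnr.
- rewrite linearB !linearZ /= !schr_rep_delta /= weyl_commutatorZr commutator_st //.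
  by rewrite scalerBr !scaler_nat !mulNrn !scalerMnr.
- by rewrite weyl_commutatorZr /commutator mulr1 mul1r subrr scaler0.
Qed.

Let table_z c : table_spec c SZ.
Proof.
rewrite /table_spec [RHS]weyl_commutatorZr /commutator mulr1 mul1r subrr scaler0.
by case: c => * /=; rewrite (linear0 schr_rep).
Qed.

(** Cancels the normalising one half against the 2 produced by the Leibniz rule; here [two_neq0]
    enters. *)
Let half2 (u : W) : 2^-1 *: (u *+ 2) = u.
Proof. by rewrite -scaler_nat scalerA mulVf ?scale1r. Qed.

Let table_h c : table_spec SH c.
Proof.
case: c => [|||p|k|k|]; last exact: table_z; rewrite /table_spec /=.
- rewrite linearZ /= schr_rep_delta /= commutatorNl weyl_commutatorZl.
  (* Of the two factors of 4, one cancels a one half and the other is the coefficient in [[h, e] = 2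
     e]. *)
  rewrite weyl_commutatorZr commutator_he // -[4%N]/(2 * 2)%N mulrnA !scalerN opprK.
  by rewrite half2 scaler_nat scalerMnr.
- rewrite linearN linearZ /= schr_rep_delta /= commutatorNl commutatorNr opprK.
  rewrite weyl_commutatorZl weyl_commutatorZr commutator_hf //.
  by rewrite -[4%N]/(2 * 2)%N mulrnA !scalerN half2 opprK scaler_nat scalerMnr.
- by rewrite (linear0 schr_rep) /commutator subrr.
- exact: (tableC (table_s p SH)).
- rewrite schr_rep_delta /= commutatorNl weyl_commutatorZl weyl_commutatorZr.
  by rewrite commutator_hd // !scalerN opprK -scalerMnr half2.
- rewrite linearN /= schr_rep_delta /= commutatorNl weyl_commutatorZl.
  by rewrite weyl_commutatorZr commutator_ht // -scalerMnr half2.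
Qed.

Let table_e c : table_spec SE c.
Proof.
case: c => [|||p|k|k|]; last exact: table_z; rewrite /table_spec /=.
- by rewrite (linear0 schr_rep) /commutator subrr.
- rewrite schr_rep_delta /= commutatorNr weyl_commutatorZl weyl_commutatorZr.
  by rewrite commutator_ef // half2.
- exact: (tableC (table_h SE)).
- exact: (tableC (table_s p SE)).
- rewrite (linear0 schr_rep) weyl_commutatorZl weyl_commutatorZr commutator_ed //.
  by rewrite !scaler0.
- rewrite schr_rep_delta /= weyl_commutatorZl weyl_commutatorZr commutator_et //.
  by rewrite -scalerMnr half2.
Qed.

Let table_f c : table_spec SF c.
Proof.
case: c => [|||p|k|k|]; last exact: table_z; rewrite /table_spec /=.
- exact: (tableC (table_e SF)).
- by rewrite (linear0 schr_rep) /commutator subrr.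
- exact: (tableC (table_h SF)).
- exact: (tableC (table_s p SF)).
- rewrite schr_rep_delta /= commutatorNl weyl_commutatorZl weyl_commutatorZr.
  by rewrite commutator_fd // !scalerN opprK -scalerMnr half2.
- rewrite (linear0 schr_rep) commutatorNl weyl_commutatorZl weyl_commutatorZr.
  by rewrite commutator_ft // !scaler0 oppr0.
Qed.

Let table_x i c : table_spec (SX i) c.
Proof.
case: c => [|||p|k|k|]; [exact/tableC/table_e|exact/tableC/table_f
  |exact/tableC/table_h|exact/tableC/table_s| | |exact: table_z]; rewrite /table_spec /=.
- by rewrite (linear0 schr_rep) weyl_commutatorZl weyl_commutatorZr dd !scaler0.
- rewrite linearZ /= schr_rep_delta /= weyl_commutatorZl weyl_commutatorZr dt.
  by rewrite [RHS]scalerA -expr2 sqE scaler_nat scalerMnr.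
Qed.

Let table_y i c : table_spec (SY i) c.
Proof.
case: c => [|||p|k|k|]; [exact/tableC/table_e|exact/tableC/table_f
  |exact/tableC/table_h|exact/tableC/table_s|exact/tableC/table_x | |exact: table_z].
by rewrite /table_spec /= (linear0 schr_rep) weyl_commutatorZl weyl_commutatorZr tt !scaler0.
Qed.

Lemma schr_rep_table b c :
  schr_rep (schr_table K b c) = commutator (schr_gen b) (schr_gen c).
Proof.
case: b => [|||p|i|i|]; [exact: table_e|exact: table_f|exact: table_h
  |exact: table_s|exact: table_x|exact: table_y|exact/tableC/table_z].
Qed.

(** Both sides are bilinear, so the verified table of basis brackets suffices. *)
Lemma schr_rep_br u v : schr_rep (lie_br u v) = commutator (schr_rep u) (schr_rep v).
Proof.
apply: (schr_br_ext (phi := schr_rep)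
  (B := fun u v => commutator (schr_rep u) (schr_rep v))) => [w a x y|w a x y|b c].
- by rewrite linearP commutatorDl weyl_commutatorZl.
- by rewrite linearP (raddfD (commutator _)) /= weyl_commutatorZr.
- by rewrite /= !schr_rep_delta schr_rep_table.
Qed.

End OscillatorRepresentation.

(** * Descent to the quotient by the central character *)

Theorem lemma1 (R : realType) (n : nat) (zdot sq : R[i]) :
  (0 < n)%N -> zdot != 0 -> sq ^+ 2 = zdot ->
  exists theta : {rmorphism schr_env_quot n zdot -> weyl_alg R[i] n},
    scalable theta /\
    (forall i : 'I_n,
      theta (schr_in zdot (schr_x R[i] i)) = sq *: weyl_d R[i] i) /\
    (forall i : 'I_n,
      theta (schr_in zdot (schr_y R[i] i)) = sq *: weyl_t R[i] i) /\
    theta (schr_in zdot (schr_e R[i] n)) =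
      2^-1 *: (\sum_(k < n) weyl_d R[i] k ^+ 2) /\
    theta (schr_in zdot (schr_f R[i] n)) =
      - (2^-1 *: (\sum_(k < n) weyl_t R[i] k ^+ 2)) /\
    theta (schr_in zdot (schr_h R[i] n)) =
      - (2^-1 *: (\sum_(k < n) (weyl_d R[i] k * weyl_t R[i] k
                                + weyl_t R[i] k * weyl_d R[i] k))) /\
    (forall i j : 'I_n,
      theta (schr_in zdot (schr_s R[i] i j)) =
        weyl_t R[i] i * weyl_d R[i] j - weyl_t R[i] j * weyl_d R[i] i).
Proof.
move=> _ _ sqE.
have two_neq0 : (2 : R[i]) != 0 by rewrite Num.Theory.pnatr_eq0.
have [g gZ gE] := @env_lift _ _ _ (@weyl_rel R[i] n)
  (schr_rep zdot sq : {linear schrodinger R[i] n -> weyl_alg R[i] n})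
  (schr_rep_br two_neq0 sqE).
(* The central element z is sent to [zdot] times the identity, so the generator of the ideal is
   killed and [g] factors through the quotient. *)
have g_rel r : @schr_central_rel R[i] n zdot r -> g r = 0.
  move=> ->; rewrite rmorphB gZ rmorph1 gE /=.
  by rewrite (schr_rep_delta zdot sq SZ) subrr.
have thetaE u : alg_lift g_rel (schr_in zdot u) = schr_rep zdot sq u.
  by rewrite [LHS]alg_lift_pi gE.
exists (alg_lift g_rel); split; first exact: alg_lift_scalable.
(* Each prescribed value is a value of [schr_rep] at a basis vector or at some [schr_s]. *)
by do !split=> *; apply: etrans (thetaE _) _; rewrite ?(schr_rep_delta, schr_rep_s).
Qed.
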